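(* Let $\alpha\in[0,1]$. Let $G_1$ be a $t_1$-regular graph of order $n_1$ and size $m_1$, and let $G_2$ be a $t_2$-regular graph of order $n_2$. (a) When $t_1=1$, the $A_\alpha$-spectrum of $G_1\underline\vee_Q G_2$ comprises: (i) one simple eigenvalue $\alpha$; (ii) the eigenvalues $\alpha+\lambda_j(A_\alpha(G_2))$ for $j=2,3,\ldots,n_2$; and (iii) three eigenvalues obtained by solving $$(\nu-\alpha)(\nu-2\alpha -\alpha n_2)(\nu-\alpha -t_2) -2(1-\alpha)^2(\nu-\alpha -t_2) -(1-\alpha)^2(\nu-\alpha)n_2=0.$$ (b) When $t_1\ge2$, the $A_\alpha$-spectrum of $G_1\underline\vee_Q G_2$ comprises: (i) one eigenvalue $\alpha(2t_1+n_2+2)-2$ with multiplicity $m_1-n_1$; (ii) the eigenvalues $\alpha m_1+\lambda_j(A_\alpha(G_2))$ for $j=2,3,\ldots,n_2$; (iii) the eigenvalues obtained by solving, for each $i=2,3,\ldots,n_1$, the equation $$\nu^2 -\big(\alpha(t_1 +n_2 +2) +t_1 -2 +\lambda_i(A_{\alpha}(G_1))\big)\nu +\alpha^2 t_1 n_2 +\big(\alpha(t_1 +1)-1\big)\big(t_1 +\lambda_i(A_{\alpha}(G_1))\big)=0;$$ and (iv) three eigenvalues obtained by solving the equation $$\begin{aligned}&(\nu-\alpha t_1)(\nu-2\alpha t_1 -\alpha n_2)(\nu-\alpha m_1 -t_2) -2(1-\alpha)(t_1 -1)(\nu-\alpha t_1 +1 -\alpha)(\nu-\alpha m_1 -t_2)\\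 &-2(1-\alpha)^2(\nu-\alpha m_1 -t_2) -m_1 n_2(1-\alpha)^2(\nu-\alpha t_1)=0.\end{aligned}$$
   Context: All graphs are undirected and simple. For a graph $G$ with adjacency matrix $A(G)$ and diagonal degree matrix $D(G)$, put $A_\alpha(G)=\alpha D(G)+(1-\alpha)A(G)$. The $A_\alpha$-spectrum of $G$ is the multiset of eigenvalues of $A_\alpha(G)$. Eigenvalues of a symmetric $n\times n$ matrix $M$ are ordered $\lambda_1(M)\ge\cdots\ge\lambda_n(M)$. The order of a graph is its number of vertices and its size is its number of edges. The $Q$-graph $\mathcal Q(G)$ is obtained from $G$ by inserting a new vertex into each edge of $G$ (so each edge is subdivided: the new vertex is adjacent to the two ends of the edge, and the original edge is no longer present), and then making two new vertices adjacent whenever they lie on adjacent edges of $G$ (distinct edges sharing an endpoint). The $Q$-edge join $G_1\underline\vee_Q G_2$ is obtained from the disjoint union of $\mathcal Q(G_1)$ and $G_2$ by joining each newly inserted vertex of $\mathcal Q(G_1)$ to every vertex of $G_2$.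
   Formalization: Part (a) is proved for n_1=2 (G_1=K_2): for t_1=1 and n_1>2 the n_2+3 listed eigenvalues are fewer than the n_1+m_1+n_2 vertices of the join, so the claim is false there; both graphs are taken to be non-empty. *)

(* Defs.v *)
From HB Require Import structures.
From mathcomp Require Import all_boot all_order all_algebra.
From mathcomp Require Import polyrcf.

Set Implicit Arguments.
Unset Strict Implicit.
Unset Printing Implicit Defensive.

Import Order.TTheory GRing.Theory Num.Theory.
Local Open Scope ring_scope.

Record sgraph : Type := SGraph {
  vertex :> finType;
  adj : rel vertex;
  adj_sym : symmetric adj;
  adj_irr : irreflexive adj
}.

Definition graph_order (G : sgraph) : nat := #|G|.

Definition edge_set (G : sgraph) : {set {set G}} :=
  [set [set p.1; p.2] | p in [pred p : G * G | adj p.1 p.2]].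

Definition edge (G : sgraph) : finType := {e : {set G} | e \in edge_set G}.

Definition graph_size (G : sgraph) : nat := #|edge_set G|.

Definition degree (G : sgraph) (x : G) : nat := #|[set y | adj x y]|.

Definition regular (t : nat) (G : sgraph) : Prop := forall x : G, degree x = t.

Section QGraph.
Variable G : sgraph.

(* [inl v] is an original vertex, [inr e] the vertex inserted into the edge e. *)
Definition Qgraph_adj (x y : (G + edge G)%type) : bool :=
  match x, y with
  | inl _, inl _ => false
  | inl v, inr e => v \in val e
  | inr e, inl v => v \in val e
  | inr e, inr f => (e != f) && (val e :&: val f != set0)
  end.

Lemma Qgraph_sym : symmetric Qgraph_adj.
Proof. by case=> [u|e] [v|f] //=; rewrite eq_sym setIC. Qed.

Lemma Qgraph_irr : irreflexive Qgraph_adj.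
Proof. by case=> [u|e] //=; rewrite eqxx. Qed.

Definition Qgraph : sgraph := SGraph Qgraph_sym Qgraph_irr.
End QGraph.

Section QEdgeJoin.
Variables G1 G2 : sgraph.

Definition Q_inserted (x : Qgraph G1) : bool := if x is inr _ then true else false.

Definition Qedge_join_adj (x y : (Qgraph G1 + G2)%type) : bool :=
  match x, y with
  | inl u, inl v => adj u v
  | inr u, inr v => adj u v
  | inl u, inr _ => Q_inserted u
  | inr _, inl v => Q_inserted v
  end.

Lemma Qedge_join_sym : symmetric Qedge_join_adj.
Proof.
case=> u [] v //; [exact: (@adj_sym (Qgraph G1)) | exact: (@adj_sym G2)].
Qed.

Lemma Qedge_join_irr : irreflexive Qedge_join_adj.
Proof. by case=> u; [exact: (@adj_irr (Qgraph G1)) | exact: (@adj_irr G2)]. Qed.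

Definition Qedge_join : sgraph := SGraph Qedge_join_sym Qedge_join_irr.
End QEdgeJoin.

Section Spectrum.
Variable R : rcfType.

Definition adj_mx (G : sgraph) : 'M[R]_#|G| :=
  \matrix_(i, j) (adj (enum_val i) (enum_val j))%:R.

Definition degree_mx (G : sgraph) : 'M[R]_#|G| :=
  diag_mx (\row_i (degree (enum_val i))%:R).

Definition Aalpha (alpha : R) (G : sgraph) : 'M[R]_#|G| :=
  alpha *: degree_mx G + (1 - alpha) *: adj_mx G.

(* [rootsR p] lists the distinct roots of p in R; here each one is repeated
   according to its multiplicity, in nonincreasing order. *)
Definition root_seq (p : {poly R}) : seq R :=
  sort >=%R (flatten [seq nseq (mup x p) x | x <- rootsR p]).

(* Only used for symmetric matrices, all of whose eigenvalues lie in R. *)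
Definition eigenvalues (n : nat) (M : 'M[R]_n) : seq R :=
  root_seq (char_poly M).

(* The j-th largest eigenvalue, counted from j = 1. *)
Definition lambda (j : nat) (n : nat) (M : 'M[R]_n) : R :=
  (eigenvalues M)`_j.-1.

Definition Aalpha_spectrum (alpha : R) (G : sgraph) : seq R :=
  eigenvalues (Aalpha alpha G).
End Spectrum.

(* Main.v *)
(* With beta = 1 - alpha and B the vertex-edge incidence matrix of G1, the matrix
   A_alpha of the join is the block matrix
     [ alpha t1 I   beta B                        0                        ]
     [ beta B^T     c I + beta B^T B              beta J                   ]
     [ 0            beta J^T                      alpha m1 I + A_alpha(G2) ]
   where c = alpha (2 t1 + n2 + 2) - 2. The all-ones vector is an eigenvector of
   A_alpha(G2), so two Schur complements reduce det (x I - A_alpha) to the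
   determinant of d I - B^T K B for d = x - c and some K commuting with the
   all-ones matrix; Sylvester's identity turns it into a determinant in
   K B B^T, and beta B B^T = A_alpha(G1) + (1 - 2 alpha) t1 I is diagonal in an
   eigenbasis of A_alpha(G1). This gives
     (X - c)^n1 * char_poly = (X - c)^m1 * (linear factors of G2)
                              * (quadratics of G1) * cubic,
   and the symmetry of A_alpha makes every factor split over the real closed
   field. The case t1 = 1 is that of G1 = K2, where n1 = m1 + 1 and the only
   quadratic is (X - c)(X - alpha). *)
Require Import Defs.
From mathcomp Require Import all_boot all_order all_algebra.
From mathcomp Require Import perm polyrcf complex ring.

Import Order.TTheory GRing.Theory Num.Theory.
Local Open Scope ring_scope.

(** * Real root lists and characteristic polynomials of symmetric matrices *)

Lemma root_seq_prod (R : rcfType) (s : seq R) :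
  perm_eq (root_seq (\prod_(x <- s) ('X - x%:P))) s.
Proof.
rewrite /root_seq perm_sort; set p := \prod_(x <- s) _.
have p0 : p != 0 by apply: monic_neq0; exact: monic_prod_XsubC.
apply/allP => y _ /=; apply/eqP.
rewrite count_flatten -map_comp sumnE big_map.
under eq_bigr do rewrite /= count_nseq /= mu_prod_XsubC.
have uR : uniq (rootsR p) by exact: uniq_roots.
have memR z : (z \in rootsR p) = (z \in s).
  by rewrite -(roots_on_rootsR p0 z) root_prod_XsubC.
have [ys|yNs] := boolP (y \in s).
  rewrite (bigD1_seq y) ?memR //= eqxx mul1n big1 ?addn0 // => i.
  by move=> /negPf ->.
rewrite (count_memPn yNs) big_seq big1 // => i.
rewrite memR => iNs; case: eqP => // iy; by rewrite iy (negPf yNs) in iNs.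
Qed.

(** A divisor of a product of linear factors is, up to a unit, the product over a subsequence; being
    monic removes the unit. The quadratics and the cubic of the join are split this way. *)
Lemma root_seq_dvd (R : rcfType) (s : seq R) (p : {poly R}) :
  p \is monic -> p %| \prod_(x <- s) ('X - x%:P) ->
  p = \prod_(x <- root_seq p) ('X - x%:P).
Proof.
move=> pm /dvdp_prod_XsubC[m]; rewrite eqp_monic ?monic_prod_XsubC // => /eqP ep.
by rewrite ep; apply/esym/perm_big/root_seq_prod.
Qed.

Lemma char_poly_conj (F : fieldType) (n : nat) (P D : 'M[F]_n) :
  P \in unitmx -> char_poly (invmx P *m D *m P) = char_poly D.
Proof.
move=> uP; rewrite /char_poly /char_poly_mx.
have PVP : map_mx polyC (invmx P) *m map_mx polyC P = 1%:M.
  by rewrite -map_mxM mulVmx // map_mx1.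
have -> : 'X%:M - map_mx polyC (invmx P *m D *m P) =
    map_mx polyC (invmx P) *m ('X%:M - map_mx polyC D) *m map_mx polyC P.
  by rewrite mulmxBr mulmxBl mul_mx_scalar -scalemxAl PVP scalemx1 !map_mxM.
by rewrite !det_mulmx mulrC mulrA mulrC -det_mulmx (mulmx1C PVP) det1 mulr1.
Qed.

(** Over [R[i]] the matrix is Hermitian, so the spectral theorem conjugates it to a diagonal matrix
    with real entries; the factorisation descends because mapping polynomials along the embedding of
    [R] is injective. *)
Lemma symmetric_char_poly_splits (R : rcfType) (n : nat) (M : 'M[R]_n) :
  M^T = M -> char_poly M = \prod_(x <- eigenvalues M) ('X - x%:P).
Proof.
move=> symM.
suff [s es] : {s : seq R | char_poly M = \prod_(x <- s) ('X - x%:P)}.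
  by rewrite /eigenvalues; apply: (@root_seq_dvd _ s); rewrite ?char_poly_monic ?es.
pose f : {rmorphism R -> R[i]} := real_complex R.
pose N := map_mx f M.
have hN : N \is hermsymmx.
  apply: realsym_hermsym.
    apply/is_hermitianmxP; rewrite expr0 scale1r; apply/matrixP => i j.
    by rewrite !mxE -[in LHS]symM mxE.
  by apply/mxOverP => i j; rewrite mxE; apply/complex_realP; exists (M i j).
have /orthomx_spectralP eN := hermitian_normalmx hN.
have /mxOverP rD := hermitian_spectral_diag_real hN.
set P := spectralmx N in eN; set D := spectral_diag N in eN rD.
exists [seq complex.Re (D 0 i) | i <- enum 'I_n]; apply: (map_poly_inj f).
rewrite map_char_poly -/N rmorph_prod /= big_map big_enum /=.
transitivity (char_poly (diag_mx D)).
  by rewrite eN char_poly_conj // spectral_unit.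
rewrite char_poly_trig ?diag_mx_is_trig //; apply: eq_bigr => i _.
rewrite map_polyXsubC mxE eqxx mulr1n; congr ('X - _%:P).
by have /complex_realP [x ->] := rD 0 i.
Qed.

Lemma size_eigenvalues (R : rcfType) (n : nat) (M : 'M[R]_n) :
  M^T = M -> size (eigenvalues M) = n.
Proof.
move=> /symmetric_char_poly_splits /(congr1 (fun p : {poly R} => size p)).
by rewrite size_char_poly size_prod_XsubC => -[].
Qed.

Lemma horner_char_poly (F : comNzRingType) (n : nat) (M : 'M[F]_n) (x : F) :
  (char_poly M).[x] = \det (x%:M - M).
Proof.
rewrite /char_poly -horner_evalE -det_map_mx; congr (\det _).
apply/matrixP => i j; rewrite !mxE /=.
by rewrite horner_evalE hornerD hornerN hornerMn hornerX hornerC.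
Qed.

(** For nonzero [w] this is the characteristic polynomial at [u / w], rescaled. The case [w = 0] is
    included because [w] will be [a + b], which can vanish at an evaluation point. *)
Lemma det_scalar_sub_scale (R : rcfType) (n : nat) (M : 'M[R]_n) (u w : R) :
  M^T = M -> \det (u%:M - w *: M) = \prod_(x <- eigenvalues M) (u - w * x).
Proof.
move=> symM; have [->|w0] := eqVneq w 0.
  rewrite scale0r subr0 det_scalar -{1}(size_eigenvalues _ _ _ symM).
  elim: (eigenvalues M) => [|x s IHs]; rewrite ?big_nil ?expr0 //= big_cons.
  by rewrite exprS IHs mul0r subr0.
have -> : u%:M - w *: M = w *: ((u / w)%:M - M).
  by rewrite scalerBr scale_scalar_mx mulrC divfK.
rewrite detZ -horner_char_poly.
rewrite symmetric_char_poly_splits // -{1}(size_eigenvalues _ _ _ symM).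
rewrite horner_prod; elim: (eigenvalues M) => [|x s IHs].
  by rewrite !big_nil expr0 mul1r.
rewrite !big_cons /= exprS mulrACA IHs; congr (_ * _).
by rewrite hornerD hornerN hornerX hornerC mulrBr mulrC divfK.
Qed.

(** Since [eigenvalue] refers to row eigenvectors, column sums matter: the triangle inequality is
    applied at a coordinate of largest absolute value. *)
Lemma eigenvalue_le_row_sum (R : rcfType) (n : nat) (M : 'M[R]_n) (t a : R) :
  (forall i j, 0 <= M i j) -> (forall j, \sum_i M i j = t) ->
  eigenvalue M a -> a <= t.
Proof.
move=> M0 Mt /eigenvalueP [v va v0].
have [k vk0] : exists k, v 0 k != 0.
  apply/existsP; apply: contraNT v0 => /existsPn v0.
  by apply/eqP/rowP => i; rewrite mxE; apply/eqP; rewrite -[_ == _]negbK.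
pose i := [arg max_(i > k) `|v 0 i|]%O.
have imax j : `|v 0 j| <= `|v 0 i| by rewrite /i; case: arg_maxP => // l _; apply.
have vi0 : 0 < `|v 0 i| by apply: lt_le_trans (imax k); rewrite normr_gt0.
rewrite -(ler_pM2r vi0); apply: le_trans (_ : `|a * v 0 i| <= _).
  by rewrite normrM ler_wpM2r // ler_norm.
have -> : a * v 0 i = (v *m M) 0 i by rewrite va mxE.
rewrite mxE -(Mt i) mulr_suml; apply: le_trans (ler_norm_sum _ _ _) _.
by apply: ler_sum => j _; rewrite normrM (ger0_norm (M0 _ _)) mulrC ler_wpM2l.
Qed.

(** The all-ones row vector attains the bound [t], so [t] heads the nonincreasing list. *)
Lemma eigenvalues_head (R : rcfType) (n : nat) (M : 'M[R]_n) (t : R) :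
  (0 < n)%N -> M^T = M ->
  (forall i j, 0 <= M i j) -> (forall j, \sum_i M i j = t) ->
  eigenvalues M = t :: [seq lambda j M | j <- index_iota 2 n.+1].
Proof.
move=> n0 symM M0 Mt.
(* [lambda] counts from 1 and [nth] from 0, so the indices 2 to [n] run exactly through the tail. *)
have tail : [seq lambda j M | j <- index_iota 2 n.+1] = behead (eigenvalues M).
  apply: (@eq_from_nth _ 0).
    by rewrite size_map size_iota size_behead size_eigenvalues // subSS subn1.
  move=> i; rewrite size_map size_iota => lti.
  by rewrite (nth_map 0%N) ?size_iota // nth_iota // nth_behead.
have memE x : x \in eigenvalues M = eigenvalue M x.
  rewrite eigenvalue_root_char symmetric_char_poly_splits //.
  by rewrite root_prod_XsubC.
have t_eig : t \in eigenvalues M.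
  rewrite memE; apply/eigenvalueP; exists (const_mx 1).
    apply/rowP => i; rewrite !mxE mulr1 -(Mt i).
    by apply: eq_bigr => j _; rewrite mxE mul1r.
  apply/eqP => /rowP /(_ (Ordinal n0)); rewrite !mxE; exact/eqP/oner_neq0.
have srt : sorted >=%R (eigenvalues M).
  by apply: sort_sorted => x y; exact: ge_total.
rewrite tail; case E: (eigenvalues M) => [|x s]; first by rewrite E in t_eig.
congr (_ :: _); apply/eqP; rewrite eq_le; apply/andP; split.
  by apply: (@eigenvalue_le_row_sum _ _ M) => //; rewrite -memE E mem_head.
move: t_eig srt; rewrite E inE => /orP[/eqP -> //|ts] /=.
by move=> /(order_path_min (rev_trans le_trans)) /allP /(_ _ ts).
Qed.

(** * Determinants of rank-one perturbations and of block matrices *)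

Lemma det_scalar_sub_mulC (F : comPzRingType) (n m : nat) (d : F)
    (C : 'M[F]_(m, n)) (D : 'M[F]_(n, m)) :
  d ^+ n * \det (d%:M - C *m D) = d ^+ m * \det (d%:M - D *m C).
Proof.
(* A right and a left multiplication each clear the lower left block of [Z]. The left multiplier has
   determinant [d ^+ n], and no inverse of [d] is taken. *)
pose Z := block_mx d%:M C D (1%:M : 'M_n).
have ZL : \det Z = \det (d%:M - C *m D).
  have := det_mulmx Z (block_mx 1%:M 0 (- D) 1%:M).
  rewrite mulmx_block !(mulmx1, mul1mx, mulmx0, mulmxN, add0r, subrr).
  by rewrite det_lblock det_ublock !det1 !mulr1 => <-.
have := det_mulmx (block_mx 1%:M 0 (- D) d%:M) Z.
rewrite mulmx_block !(mul1mx, mul0mx, addr0, mulmx1, mulNmx).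
rewrite mul_mx_scalar mul_scalar_mx addNr det_lblock det_ublock !det_scalar.
by rewrite !expr1n !mul1r ZL addrC => ->.
Qed.

(** As the all-ones vector is an eigenvector, [P] factors out of the perturbed matrix even when it
    is singular; Sylvester's identity with [d = 1] leaves a 1 by 1 determinant. *)
Lemma det_sub_const_mx (F : fieldType) (n : nat) (P : 'M[F]_n) (p k : F) :
  p != 0 -> P *m const_mx 1 = p *: (const_mx 1 : 'cV_n) ->
  \det (P - const_mx k) * p = \det P * (p - k * n%:R).
Proof.
move=> p0 Pu; set u : 'cV_n := const_mx 1 in Pu.
have uuE c : c *: (u *m u^T) = const_mx c.
  by apply/matrixP => i j; rewrite !mxE big_ord1 !mxE !mulr1.
have -> : P - const_mx k = P *m (1%:M - ((k / p) *: u) *m u^T).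
  rewrite mulmxBr mulmx1 mulmxA -scalemxAr Pu scalerA divfK // -scalemxAl.
  by rewrite uuE.
have := det_scalar_sub_mulC _ _ _ 1 ((k / p) *: u) u^T.
rewrite det_mulmx !expr1n !mul1r => ->.
have -> : 1%:M - u^T *m ((k / p) *: u) = (1 - k / p * n%:R)%:M :> 'M_1.
  rewrite -scalemxAr; apply/matrixP => i j; rewrite !ord1 !mxE /= !mulr1n.
  congr (_ - _ * _); rewrite -[in RHS](card_ord n) -sumr_const.
  by apply: eq_bigr => l _; rewrite !mxE mulr1.
by rewrite det_scalar1; field.
Qed.

(** The column operation that clears the lower left block uses [P u = p u] in place of an inverse of
    [P], so only [p] must be nonzero. *)
Lemma det_eliminate_const (F : fieldType) (n m : nat) (X : 'M[F]_m)
    (P : 'M[F]_n) (p b : F) (w : 'cV[F]_m) :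
  p != 0 -> P *m const_mx 1 = p *: (const_mx 1 : 'cV_n) ->
  \det (block_mx X (- b *: (w *m const_mx 1)) (- b *: (const_mx 1 *m w^T)) P)
    = \det P * \det (X - (b ^+ 2 * n%:R / p) *: (w *m w^T)).
Proof.
move=> p0 Pu; set u : 'cV_n := const_mx 1 in Pu *.
have uE : const_mx 1 = u^T by rewrite trmx_const.
rewrite uE.
have uu : u^T *m u = n%:R%:M.
  apply/matrixP => i j; rewrite !ord1 !mxE /= !mulr1n.
  rewrite -[in RHS](card_ord n) -sumr_const.
  by apply: eq_bigr => l _; rewrite !mxE mulr1.
pose Z := block_mx X (- b *: (w *m u^T)) (- b *: (u *m w^T)) P.
have := det_mulmx Z (block_mx 1%:M 0 ((b / p) *: (u *m w^T)) 1%:M).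
rewrite -/Z mulmx_block det_lblock !det1 !mulr1 !mulmx1 !mulmx0 !add0r => <-.
have -> : - b *: (u *m w^T) + P *m (b / p *: (u *m w^T)) = 0.
  rewrite -scalemxAr mulmxA Pu -scalemxAl scalerA divfK // scaleNr.
  by rewrite addNr.
have -> : - b *: (w *m u^T) *m (b / p *: (u *m w^T)) =
    - ((b ^+ 2 * n%:R / p) *: (w *m w^T)).
  rewrite -scalemxAl -scalemxAr scalerA mulmxA -(mulmxA w) uu.
  rewrite mul_mx_scalar -scalemxAl scalerA -scaleNr; congr (_ *: _); by field.
by rewrite det_ublock mulrC.
Qed.

Lemma det_eliminate_scalar (F : fieldType) (n m : nat) (B : 'M[F]_(n, m))
    (Y : 'M[F]_m) (a b : F) :
  a != 0 ->
  \det (block_mx a%:M (- b *: B) (- b *: B^T) Y)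
    = a ^+ n * \det (Y - (b ^+ 2 / a) *: (B^T *m B)).
Proof.
move=> a0; set Z := block_mx _ _ _ _.
have := det_mulmx Z (block_mx 1%:M ((b / a) *: B) 0 1%:M).
rewrite mulmx_block det_ublock !det1 !mulr1 !mulmx1 !mulmx0 !addr0 => <-.
have -> : a%:M *m (b / a *: B) + - b *: B = 0.
  by rewrite mul_scalar_mx scalerA mulrC divfK // scaleNr subrr.
have -> : - b *: B^T *m (b / a *: B) = - ((b ^+ 2 / a) *: (B^T *m B)).
  rewrite -scalemxAl -scalemxAr scalerA -scaleNr; congr (_ *: _); by field.
by rewrite det_lblock det_scalar addrC.
Qed.

(** Here [q] is the eigenvalue of [(a * d)%:M - (b * (a + b)) *: (B *m B^T)] at the all-ones vector,
    because [B B^T] has row sums [2 t]. The factors [d ^+ n], [p] and [q] on the left leave 2 as the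
    only denominator. *)
Lemma det_join_block (F : fieldType) (n m k : nat) (B : 'M[F]_(n, m))
    (P : 'M[F]_k) (a b d p t : F) (q := a * d - b * (a + b) * (2 * t)) :
  2 != 0 :> F -> a != 0 -> p != 0 -> q != 0 ->
  const_mx 1 *m B = const_mx 2 :> 'rV_m ->
  B *m const_mx 1 = const_mx t :> 'cV_n ->
  P *m const_mx 1 = p *: const_mx 1 :> 'cV_k ->
  \det (block_mx
         (block_mx a%:M (- b *: B) (- b *: B^T) (d%:M - b *: (B^T *m B)))
         (- b *: col_mx 0 (const_mx 1)) (- b *: row_mx 0 (const_mx 1)) P)
    * d ^+ n * p * q
  = d ^+ m * \det P * \det ((a * d)%:M - (b * (a + b)) *: (B *m B^T))
    * (p * q - a * b ^+ 2 * k%:R * t * n%:R / 2).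
Proof.
move=> two0 a0 p0 q0 uB Bu Pu.
pose w : 'cV[F]_(n + m) := col_mx 0 (const_mx 1).
have -> : col_mx 0 (const_mx 1) = w *m (const_mx 1 : 'rV_k).
  rewrite mul_col_mx mul0mx; congr col_mx.
  by apply/matrixP => i j; rewrite !mxE big_ord1 !mxE mulr1.
have -> : row_mx 0 (const_mx 1) = (const_mx 1 : 'cV_k) *m w^T.
  rewrite tr_col_mx mul_mx_row trmx0 mulmx0; congr row_mx.
  by apply/matrixP => i j; rewrite !mxE big_ord1 !mxE mulr1.
rewrite (det_eliminate_const _ _ _ _ _ p) //.
set J : 'M[F]_n := const_mx 1.
(* The columns of [B] sum to 2, so the all-ones block on the edges is a quarter of [B^T J B] and
   fits the form [B^T K B]. *)
have -> : w *m w^T = block_mx 0 0 0 (2^-1 ^+ 2 *: (B^T *m J *m B)).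
  have -> : J = (const_mx 1 : 'cV_n) *m (const_mx 1 : 'rV_n).
    by apply/matrixP => i j; rewrite !mxE big_ord1 !mxE mulr1.
  rewrite !mulmxA -mulmxA uB -(trmxK (B^T *m _)) trmx_mul trmxK trmx_const uB.
  rewrite /w tr_col_mx mul_col_row !trmx0 !(mul0mx, mulmx0); congr block_mx.
  apply/matrixP => i j; rewrite !mxE !big_ord1 !mxE; field.
  by rewrite two0.
rewrite scale_block_mx !scaler0 opp_block_mx add_block_mx !subr0.
rewrite det_eliminate_scalar // scalerA.
set e := b ^+ 2 * k%:R / p * _.
have -> : d%:M - b *: (B^T *m B) - e *: (B^T *m J *m B)
    - b ^+ 2 / a *: (B^T *m B) =
    d%:M - B^T *m (((b + b ^+ 2 / a)%:M + e *: J) *m B).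
  rewrite mulmxDl mulmxDr mul_scalar_mx -!scalemxAl -!scalemxAr mulmxA.
  by rewrite scalerDl !opprD !addrA [RHS]addrAC.
set D := \det (_ - _).
have := det_scalar_sub_mulC _ _ _ d B^T (((b + b ^+ 2 / a)%:M + e *: J) *m B).
rewrite -/D => eD.
(* Scaling by [a] and using [J B B^T = 2 t J] gives a constant perturbation of a matrix with
   eigenvalue [q], as [det_sub_const_mx] requires. *)
have eQ : a ^+ n * \det (d%:M - ((b + b ^+ 2 / a)%:M + e *: J) *m B *m B^T) * q
    = \det ((a * d)%:M - (b * (a + b)) *: (B *m B^T))
      * (q - a * e * (2 * t) * n%:R).
  rewrite -detZ -det_sub_const_mx //.
    congr (\det _ * _); rewrite scalerBr scale_scalar_mx -!mulmxA.
    rewrite mulmxDl mul_scalar_mx -scalemxAl scalerDr !scalerA opprD addrA.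
    congr (_ - _ *: _ - _); first by field.
    have -> : J *m (B *m B^T) = (2 * t) *: J.
      have -> : J = (const_mx 1 : 'cV_n) *m (const_mx 1 : 'rV_n).
        by apply/matrixP => i j; rewrite !mxE big_ord1 !mxE mulr1.
      rewrite -mulmxA (mulmxA _ B) uB [in RHS]scalemxAr; congr (_ *m _).
      apply: trmx_inj; rewrite trmx_mul trmxK trmx_const.
      have -> : const_mx 2 = 2 *: const_mx 1 :> 'cV[F]_m.
        by apply/matrixP => i j; rewrite !mxE mulr1.
      rewrite -scalemxAr Bu; apply/matrixP => i j; rewrite !mxE; ring.
    by rewrite scalerA; apply/matrixP => i j; rewrite !mxE; ring.
  rewrite mulmxBl mul_scalar_mx -scalemxAl -mulmxA.
  have -> : B^T *m const_mx 1 = const_mx 2 :> 'cV[F]_m.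
    by apply: trmx_inj; rewrite trmx_mul trmxK !trmx_const.
  have -> : const_mx 2 = 2 *: const_mx 1 :> 'cV[F]_m.
    by apply/matrixP => i j; rewrite !mxE mulr1.
  rewrite -scalemxAr Bu /q; apply/matrixP => i j; rewrite !mxE; ring.
transitivity (\det P * (a ^+ n * (d ^+ n * D) * q) * p); first by ring.
rewrite eD.
transitivity (d ^+ m * \det P * p * (a ^+ n *
   \det (d%:M - ((b + b ^+ 2 / a)%:M + e *: J) *m B *m B^T) * q)); first by ring.
rewrite eQ /e; field.
by rewrite p0 two0.
Qed.

(** * Counting incidences between vertices and edges *)

Lemma edge_setP (G : sgraph) (s : {set G}) :
  reflect (exists x y, adj x y /\ s = [set x; y]) (s \in edge_set G).
Proof.
apply: (iffP imsetP) => [[[x y] /= xy ->]|[x [y [xy ->]]]]; first by exists x, y.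
by exists (x, y).
Qed.

Lemma adj_neq (G : sgraph) (x y : G) : adj x y -> x != y.
Proof. by apply: contraTneq => ->; rewrite adj_irr. Qed.

Lemma edge_card (G : sgraph) (e : edge G) : #|val e| = 2%N.
Proof. by have /edge_setP[x [y [/adj_neq xy ->]]] := valP e; rewrite cards2 xy. Qed.

Lemma sum_incident_vertices (G : sgraph) (e : edge G) :
  (\sum_(v : G) (v \in val e) = 2)%N.
Proof. by rewrite -(edge_card _ e) -sum1_card [RHS]big_mkcond. Qed.

Lemma edge_through (G : sgraph) (u v : G) (e : edge G) :
  u != v -> u \in val e -> v \in val e -> val e = [set u; v].
Proof.
move=> uv ue ve; apply/esym/eqP; rewrite eqEcard edge_card cards2 uv andbT.
by apply/subsetP => z /set2P[] ->.
Qed.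

Lemma adj_edge (G : sgraph) (u v : G) (e : edge G) :
  u != v -> u \in val e -> v \in val e -> adj u v.
Proof.
move=> uv ue ve; have /edge_setP[x [y [xy exy]]] := valP e.
move: ue ve uv; rewrite exy => /set2P[] -> /set2P[] -> //; rewrite ?eqxx //.
by rewrite adj_sym.
Qed.

(** The only edge that can contain both vertices is [[set u; v]]. These sums are the off-diagonal
    entries of [B B^T]. *)
Lemma sum_edges_through (G : sgraph) (u v : G) : u != v ->
  (\sum_(e : edge G) (u \in val e) * (v \in val e) = adj u v)%N.
Proof.
move=> uv; case: (boolP (adj u v)) => [auv|nuv].
  have uvE : [set u; v] \in edge_set G by apply/edge_setP; exists u, v.
  rewrite (bigD1 (Sub [set u; v] uvE : edge G)) //= set21 set22 big1 // => e nee.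
  apply/eqP; rewrite -[(_ * _)%N == _]negbK -lt0n mulnb lt0b; apply: contra nee.
  by case/andP => ue ve; apply/eqP/val_inj; exact: edge_through.
rewrite big1 // => e _; apply/eqP; rewrite mulnb eqb0; apply: contra nuv.
by case/andP; exact: adj_edge.
Qed.

(** Each edge through [v] has exactly one other end, so the incidences regroup by neighbours of
    [v]. *)
Lemma sum_incident_edges (G : sgraph) (v : G) :
  (\sum_(e : edge G) (v \in val e) = degree v)%N.
Proof.
rewrite /degree -sum1_card [RHS]big_mkcond /=.
transitivity (\sum_(e : edge G) \sum_(u | u != v) (v \in val e) * (u \in val e))%N.
  apply: eq_bigr => e _; rewrite -big_distrr /=.
  have := sum_incident_vertices _ e; rewrite (bigD1 v) //=.
  by case: (v \in val e) => /=; rewrite ?mul0n // add1n => -[->].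
rewrite exchange_big /= [LHS]big_mkcond /=; apply: eq_bigr => u _; rewrite inE eq_sym.
case: eqVneq => [<-|uv] /=; first by rewrite adj_irr.
by rewrite sum_edges_through //; case: adj.
Qed.

(** Distinct edges share at most one vertex, and an edge shares two with itself. In matrix form,
    [B^T B] is twice the identity plus the adjacency matrix of the line graph. *)
Lemma sum_common_vertices (G : sgraph) (e f : edge G) :
  (\sum_(v : G) (v \in val e) * (v \in val f)
     = Qgraph_adj (inr e) (inr f) + 2 * (e == f))%N.
Proof.
under eq_bigr do rewrite mulnb -in_setI.
have -> : (\sum_v (v \in val e :&: val f) = #|val e :&: val f|)%N.
  by rewrite -sum1_card [RHS]big_mkcond.
rewrite /=; case: eqVneq => [->|ef] /=; first by rewrite setIid edge_card.
rewrite addn0 -card_gt0.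
have : (#|val e :&: val f| <= 1)%N; last by case: #|_| => [|[]].
rewrite leqNgt; apply: contra ef => /card_gt1P[u [v [ue ve uv]]].
move: ue ve; rewrite !inE => /andP[ue uf] /andP[ve vf].
apply/eqP/val_inj; rewrite (edge_through _ _ _ _ uv ue ve).
by rewrite (edge_through _ _ _ _ uv uf vf).
Qed.

Lemma degree_sum (G : sgraph) (x : G) : degree x = (\sum_(y : G) adj x y)%N.
Proof.
by rewrite /degree -sum1_card big_mkcond; apply: eq_bigr => y _; rewrite inE.
Qed.

(** * Vertex degrees in the Q-edge join *)

Section RegularDegrees.
Variables (G1 G2 : sgraph) (t1 t2 : nat).
Hypotheses (reg1 : regular t1 G1) (reg2 : regular t2 G2).

(** A row of [B^T B] sums to [2 * t1], and its diagonal entry is the summand 2, kept on the left to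
    avoid truncated subtraction. *)
Lemma sum_adjacent_edges (e : edge G1) :
  (\sum_(f : edge G1) Qgraph_adj (inr e) (inr f) + 2 = 2 * t1)%N.
Proof.
have -> : (2 * t1 = \sum_(f : edge G1) \sum_(v : G1) (v \in val e) * (v \in val f))%N.
  rewrite exchange_big -(sum_incident_vertices _ e) big_distrl /=.
  by apply: eq_bigr => v _; rewrite -big_distrr /= sum_incident_edges reg1.
under [RHS]eq_bigr do rewrite sum_common_vertices.
rewrite big_split /= -big_distrr /= (bigD1 e) //=; congr (_ + _)%N.
rewrite (bigD1 e) //= eqxx big1 // => f; by rewrite eq_sym => /negPf ->.
Qed.

Lemma degree_join_vertex (v : G1) :
  degree (inl (inl v) : Qedge_join G1 G2) = t1.
Proof.
rewrite degree_sum big_sumType /= big_sumType /= !big1_eq add0n addn0.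
by rewrite sum_incident_edges.
Qed.

Lemma degree_join_edge (e : edge G1) :
  degree (inl (inr e) : Qedge_join G1 G2) = (2 * t1 + #|G2|)%N.
Proof.
rewrite degree_sum big_sumType /= big_sumType /=.
congr (_ + _)%N; last by rewrite sum1_card.
by rewrite -(sum_adjacent_edges e) sum_incident_vertices addnC.
Qed.

Lemma degree_join_right (v : G2) :
  degree (inr v : Qedge_join G1 G2) = (#|edge G1| + t2)%N.
Proof.
rewrite degree_sum big_sumType /= big_sumType /= big1_eq add0n.
by rewrite sum1_card -degree_sum reg2.
Qed.

End RegularDegrees.

(** * Reordering the vertices of the join into blocks *)

Lemma det_reindex (F : comNzRingType) (T : finType) (n : nat) (h : 'I_n -> T)
    (f : T -> T -> F) :
  bijective h ->
  \det (\matrix_(i < #|T|, j < #|T|) f (enum_val i) (enum_val j))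
    = \det (\matrix_(i, j) f (h i) (h j)).
Proof.
move=> bh; have en : n = #|T| by rewrite -(bij_eq_card bh) card_ord.
subst n.
have inj_s : injective (fun i => enum_rank (h i)).
  by move=> i j /enum_rank_inj /(bij_inj bh).
set A := \matrix_(i, j) f (enum_val i) _.
have -> : \matrix_(i, j) f (h i) (h j)
    = row_perm (perm inj_s) (col_perm (perm inj_s) A).
  by apply/matrixP => i j; rewrite !mxE !permE !enum_rankK.
(* Rows and columns move by the same permutation, so its sign occurs twice and cancels. *)
rewrite row_permE col_permE !det_mulmx !det_perm odd_permV.
by rewrite mulrC -mulrA -signr_addb addbb mulr1.
Qed.

Definition join_index (G1 G2 : sgraph)
    (i : 'I_(#|G1| + #|edge G1| + #|G2|)) : Qedge_join G1 G2 :=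
  match split i with
  | inl j => inl (match split j with
                  | inl u => inl (enum_val u)
                  | inr e => inr (enum_val e)
                  end)
  | inr v => inr (enum_val v)
  end.

Lemma join_index_bij (G1 G2 : sgraph) : bijective (@join_index G1 G2).
Proof.
exists (fun x : Qedge_join G1 G2 => match x with
  | inl (inl u) => lshift _ (lshift _ (enum_rank u))
  | inl (inr e) => lshift _ (rshift _ (enum_rank e))
  | inr v => rshift _ (enum_rank v)
  end).
- move=> i; rewrite /join_index -[RHS]splitK; case: (split i) => j //=.
    by rewrite -[in RHS](splitK j); case: (split j) => k /=; rewrite enum_valK.
  by rewrite enum_valK.
- case=> [[u|e]|v]; rewrite /join_index.
  + by rewrite !(unsplitK (inl _)) enum_rankK.
  + by rewrite (unsplitK (inl _)) (unsplitK (inr _)) enum_rankK.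
  + by rewrite (unsplitK (inr _)) enum_rankK.
Qed.

(** * The incidence matrix and its relation to the A_alpha matrices *)

Definition incidence_mx (R : rcfType) (G : sgraph) : 'M[R]_(#|G|, #|edge G|) :=
  \matrix_(i < #|G|, e < #|edge G|) (enum_val i \in val (enum_val e : edge G))%:R.

Section Matrices.
Variables (R : rcfType) (alpha : R) (G : sgraph) (t : nat).
Hypothesis reg : regular t G.

Lemma sum_enum_val (T : finType) (f : T -> R) :
  \sum_(i < #|T|) f (enum_val i) = \sum_x f x.
Proof. by rewrite [RHS](reindex (@enum_val T T)) //; exact/onW_bij/enum_val_bij. Qed.

Lemma AalphaE i j :
  Aalpha alpha G i j
    = alpha * t%:R * (i == j)%:R + (1 - alpha) * (adj (enum_val i) (enum_val j))%:R.
Proof. by rewrite !mxE reg -[X in alpha * X]mulr_natr mulrA. Qed.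

Lemma Aalpha_sym : (Aalpha alpha G)^T = Aalpha alpha G.
Proof. by apply/matrixP => i j; rewrite mxE !AalphaE eq_sym adj_sym. Qed.

Lemma Aalpha_col_sum j : \sum_i Aalpha alpha G i j = t%:R.
Proof.
under eq_bigr do rewrite AalphaE.
rewrite big_split /= -!mulr_sumr (bigD1 j) //= eqxx big1 => [|i /negPf -> //].
rewrite (sum_enum_val G (fun x => (adj x (enum_val j))%:R)) -natr_sum.
under eq_bigr do rewrite adj_sym.
by rewrite -degree_sum reg mulr1n; ring.
Qed.

Lemma mul_Aalpha_ones :
  Aalpha alpha G *m const_mx 1 = t%:R *: const_mx 1 :> 'cV_#|G|.
Proof.
rewrite -[X in X *m _]Aalpha_sym; apply/matrixP => i j; rewrite !mxE mulr1.
rewrite -[RHS](Aalpha_col_sum i).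
by apply: eq_bigr => k _; rewrite [X in X * _]mxE [X in _ * X]mxE mulr1.
Qed.

Lemma ones_mul_incidence :
  const_mx 1 *m incidence_mx R G = const_mx 2 :> 'rV_#|edge G|.
Proof.
apply/matrixP => i e; rewrite !mxE.
under eq_bigr do rewrite !mxE mul1r.
rewrite (sum_enum_val G (fun x => (x \in val (enum_val e : edge G))%:R)).
by rewrite -natr_sum sum_incident_vertices.
Qed.

Lemma incidence_mul_ones :
  incidence_mx R G *m const_mx 1 = const_mx t%:R :> 'cV_#|G|.
Proof.
apply/matrixP => i e; rewrite !mxE.
under eq_bigr do rewrite !mxE mulr1.
rewrite (sum_enum_val (edge G) (fun x => (enum_val i \in val x)%:R)).
by rewrite -natr_sum sum_incident_edges reg.
Qed.

(** For a [t]-regular graph, [B B^T] is [t I] plus the adjacency matrix; expressing the latter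
    through [Aalpha] changes the constant [(1 - alpha) t] into [(1 - alpha) t - alpha t]. *)
Lemma incidence_mul_tr :
  (1 - alpha) *: (incidence_mx R G *m (incidence_mx R G)^T)
    = Aalpha alpha G + ((1 - 2 * alpha) * t%:R)%:M.
Proof.
apply/matrixP => i j; rewrite mxE [RHS]mxE AalphaE !mxE.
under eq_bigr do rewrite !mxE -natrM.
rewrite (sum_enum_val (edge G)
  (fun x => ((enum_val i \in val x) * (enum_val j \in val x))%:R)) -natr_sum.
case: eqVneq => [->|ij].
  under eq_bigr do rewrite mulnb andbb.
  by rewrite sum_incident_edges reg adj_irr !mulr1n mulr0n; ring.
rewrite sum_edges_through ?(inj_eq enum_val_inj) //.
by rewrite mulr0n mulr0 add0r addr0.
Qed.

End Matrices.

Lemma handshake (G : sgraph) (t : nat) :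
  regular t G -> (2 * graph_size G = t * graph_order G)%N.
Proof.
move=> reg.
have -> : graph_size G = #|edge G| by rewrite /graph_size card_sig.
have -> : (2 * #|edge G| = \sum_(e : edge G) \sum_(v : G) (v \in val e))%N.
  under eq_bigr do rewrite sum_incident_vertices.
  by rewrite sum_nat_const mulnC.
rewrite exchange_big /=; under eq_bigr do rewrite sum_incident_edges reg.
by rewrite sum_nat_const mulnC.
Qed.

(** On inserted vertices the degree is [2 t1 + n2] and the adjacency matrix is [B^T B - 2 I]. The
    correction [2 (1 - alpha)] produces the constant [alpha (2 t1 + n2 + 2) - 2]. *)
Lemma horner_char_poly_join (R : rcfType) (alpha : R) (G1 G2 : sgraph)
    (t1 t2 : nat) (x : R) (B := incidence_mx R G1) :
  regular t1 G1 -> regular t2 G2 ->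
  (char_poly (Aalpha alpha (Qedge_join G1 G2))).[x] =
  \det (block_mx
    (block_mx (x - alpha * t1%:R)%:M (- (1 - alpha) *: B)
       (- (1 - alpha) *: B^T)
       ((x - (alpha * (2 * t1%:R + #|G2|%:R + 2) - 2))%:M
          - (1 - alpha) *: (B^T *m B)))
    (- (1 - alpha) *: col_mx 0 (const_mx 1))
    (- (1 - alpha) *: row_mx 0 (const_mx 1))
    ((x - alpha * #|edge G1|%:R)%:M - Aalpha alpha G2)).
Proof.
move=> reg1 reg2; rewrite horner_char_poly.
pose f (u v : Qedge_join G1 G2) : R :=
  (x - alpha * (degree u)%:R) * (u == v)%:R - (1 - alpha) * (adj u v)%:R.
have -> : x%:M - Aalpha alpha (Qedge_join G1 G2) =
    \matrix_(i, j) f (enum_val i) (enum_val j).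
  apply/matrixP => i j; rewrite !mxE /f (inj_eq enum_val_inj).
  by case: eqVneq => _; rewrite ?mulr1n ?mulr0n; ring.
rewrite (det_reindex _ _ _ _ f (join_index_bij G1 G2)); congr (\det _).
apply/matrixP => i j; rewrite mxE -[in RHS](splitK i) -[in RHS](splitK j).
rewrite /join_index; case: (split i) => {}i; case: (split j) => {}j /=.
- rewrite block_mxEul -[in RHS](splitK i) -[in RHS](splitK j).
  case: (split i) => {}i; case: (split j) => {}j /=; rewrite /f.
  + rewrite block_mxEul (degree_join_vertex _ _ _ reg1) !mxE.
    rewrite !(inj_eq inl_inj) (inj_eq enum_val_inj) mulr0 subr0.
    by rewrite mulr_natr.
  + rewrite block_mxEur !mxE (inj_eq inl_inj) /= mulr0 sub0r mulNr //.
  + rewrite block_mxEdl !mxE (inj_eq inl_inj) /= mulr0 sub0r mulNr //.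
  + rewrite block_mxEdr (degree_join_edge _ _ _ reg1) !mxE.
    under eq_bigr do rewrite !mxE -natrM.
    rewrite (sum_enum_val R G1 (fun v =>
       ((v \in val (enum_val i : edge G1)) *
        (v \in val (enum_val j : edge G1)))%:R)) -natr_sum.
    rewrite sum_common_vertices !(inj_eq inl_inj) (inj_eq inr_inj).
    rewrite !(inj_eq enum_val_inj) natrD natrM natrD natrM.
    case: (i == j); rewrite ?mulr1n ?mulr0n; ring.
- rewrite block_mxEur [RHS]mxE /f -[in RHS](splitK i).
  case: (split i) => {}i /=; rewrite ?col_mxEu ?col_mxEd mxE /=; ring.
- rewrite block_mxEdl [RHS]mxE /f -[in RHS](splitK j).
  case: (split j) => {}j /=; rewrite ?row_mxEl ?row_mxEr mxE /=; ring.
- rewrite block_mxEdr /f (degree_join_right _ _ _ reg2) [RHS]mxE [X in _ = _ + X]mxE.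
  rewrite (AalphaE _ _ _ _ reg2) (inj_eq inr_inj) (inj_eq enum_val_inj) !mxE.
  rewrite natrD /=; case: (i == j); rewrite ?mulr1n ?mulr0n; ring.
Qed.

(** * Polynomial identities from evaluation, and monic factors *)

Lemma poly_eq_off_roots (R : numDomainType) (p q h : {poly R}) :
  h != 0 -> (forall x, h.[x] != 0 -> p.[x] = q.[x]) -> p = q.
Proof.
move=> h0 pq; apply/eqP; rewrite -subr_eq0.
suff : h * (p - q) == 0 by rewrite mulf_eq0 (negPf h0).
(* [r] vanishes everywhere, in particular at [size r] distinct natural numbers, too many for a
   nonzero polynomial. *)
apply: contraT => r0; set r := h * (p - q) in r0.
have := max_poly_roots r0 (rs := [seq k%:R | k <- iota 0 (size r)]).
rewrite size_map size_iota ltnn; apply.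
  apply/allP => _ /mapP[k _ ->]; rewrite /root hornerM hornerD hornerN.
  by have [->|/pq ->] := eqVneq h.[k%:R] 0; rewrite ?mul0r // subrr mulr0.
rewrite map_inj_uniq ?iota_uniq // => i j /eqP.
by rewrite eqr_nat => /eqP.
Qed.

Lemma monic_quadratic (R : nzRingType) (a b : R) :
  size ('X^2 + a%:P * 'X + b%:P) = 3%N /\ 'X^2 + a%:P * 'X + b%:P \is monic.
Proof.
have -> : 'X^2 + a%:P * 'X + b%:P = 'X^2 + Poly [:: b; a].
  by rewrite -addrA /= !cons_poly_def mul0r add0r.
have lt : (size (Poly [:: b; a]) < size ('X^2 : {poly R}))%N.
  by rewrite size_polyXn ltnS size_Poly.
by rewrite size_polyDl // monicE lead_coefDl // lead_coefXn size_polyXn.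
Qed.

Lemma monic_cubic (R : nzRingType) (a b c : R) :
  size ('X^3 + a%:P * 'X^2 + b%:P * 'X + c%:P) = 4%N
  /\ 'X^3 + a%:P * 'X^2 + b%:P * 'X + c%:P \is monic.
Proof.
have -> : 'X^3 + a%:P * 'X^2 + b%:P * 'X + c%:P = 'X^3 + Poly [:: c; b; a].
  by rewrite /= !cons_poly_def mul0r add0r mulrDl -mulrA -expr2 !addrA.
have lt : (size (Poly [:: c; b; a]) < size ('X^3 : {poly R}))%N.
  by rewrite size_polyXn ltnS size_Poly.
by rewrite size_polyDl // monicE lead_coefDl // lead_coefXn size_polyXn.
Qed.

(** Compares subleading coefficients. It yields the second eigenvalue when [G1] is K2. *)
Lemma sum_eigenvalues (R : rcfType) (n : nat) (M : 'M[R]_n) :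
  (0 < n)%N -> M^T = M -> \sum_(x <- eigenvalues M) x = \tr M.
Proof.
move=> n0 symM; apply: oppr_inj; rewrite -char_poly_trace //.
rewrite symmetric_char_poly_splits //.
have sz := size_eigenvalues _ _ _ symM.
have -> : n.-1 = (size (eigenvalues M)).-1 by rewrite sz.
by rewrite coefPn_prod_XsubC // sz -lt0n.
Qed.

(** * The characteristic polynomial of the join *)

Section JoinPolynomial.
Variables (R : rcfType) (alpha : R) (G1 G2 : sgraph) (t1 t2 : nat).
Hypotheses (alpha01 : 0 <= alpha <= 1) (reg1 : regular t1 G1).
Hypotheses (reg2 : regular t2 G2) (G1_gt0 : (0 < #|G1|)%N) (G2_gt0 : (0 < #|G2|)%N).

Let m1 := #|edge G1|.
Let n2 := #|G2|.
Let c : R := alpha * (2 * t1%:R + n2%:R + 2) - 2.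

(** At [x] this is the eigenvalue of [(a * d)%:M - (b * (a + b)) *: (B *m B^T)] on an eigenvector of
    [Aalpha alpha G1] for [l]. *)
Definition join_quadratic (l : R) : {poly R} :=
  'X ^+ 2 - (alpha * (t1%:R + #|G2|%:R + 2) + t1%:R - 2 + l)%:P * 'X
  + (alpha ^+ 2 * t1%:R * #|G2|%:R + (alpha * (t1%:R + 1) - 1) * (t1%:R + l))%:P.

(** The characteristic polynomial of the 3 by 3 quotient matrix for the partition into original
    vertices, inserted vertices and [G2]. *)
Definition join_cubic : {poly R} :=
  ('X - (alpha * t1%:R)%:P)
    * ('X - (2 * alpha * t1%:R)%:P - (alpha * #|G2|%:R)%:P)
    * ('X - (alpha * #|edge G1|%:R)%:P - (t2%:R)%:P)
  - (2 * (1 - alpha) * (t1%:R - 1))%:P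
    * ('X - (alpha * t1%:R)%:P + 1 - alpha%:P)
    * ('X - (alpha * #|edge G1|%:R)%:P - (t2%:R)%:P)
  - (2 * (1 - alpha) ^+ 2)%:P * ('X - (alpha * #|edge G1|%:R)%:P - (t2%:R)%:P)
  - (#|edge G1|%:R * #|G2|%:R * (1 - alpha) ^+ 2)%:P * ('X - (alpha * t1%:R)%:P).

Lemma join_quadratic_monic (l : R) : join_quadratic l \is monic.
Proof.
rewrite /join_quadratic; set a := _ + l; set b := (X in _ + X%:P).
by have [_] := monic_quadratic _ (- a) b; rewrite rmorphN mulNr.
Qed.

Lemma join_cubic_monic : size join_cubic = 4%N /\ join_cubic \is monic.
Proof.
pose u := alpha * t1%:R; pose v := 2 * u + alpha * #|G2|%:R.
pose w := alpha * #|edge G1|%:R + t2%:R; pose k := 2 * (1 - alpha) * (t1%:R - 1).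
pose z := u - 1 + alpha; pose g := 2 * (1 - alpha) ^+ 2.
pose e := #|edge G1|%:R * #|G2|%:R * (1 - alpha) ^+ 2.
suff -> : join_cubic = 'X^3 + (- (u + v + w) - k)%:P * 'X^2
    + (u * v + u * w + v * w + k * (z + w) - g - e)%:P * 'X
    + (- (u * v * w) - k * z * w + g * w + e * u)%:P by exact: monic_cubic.
by rewrite /join_cubic /e /g /z /k /w /v /u; ring.
Qed.

Lemma Aalpha_ge0 (G : sgraph) (t : nat) : regular t G ->
  forall i j, 0 <= Aalpha alpha G i j.
Proof.
move=> reg i j; rewrite (AalphaE _ _ _ _ reg); case/andP: alpha01 => a0 a1.
by rewrite addr_ge0 ?mulr_ge0 ?ler0n ?subr_ge0.
Qed.

Lemma Aalpha_eigenvalues (G : sgraph) (t : nat) : regular t G -> (0 < #|G|)%N ->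
  eigenvalues (Aalpha alpha G)
    = t%:R :: [seq lambda j (Aalpha alpha G) | j <- index_iota 2 #|G|.+1].
Proof.
move=> reg G0; apply: eigenvalues_head => //.
- exact: Aalpha_sym reg.
- exact: Aalpha_ge0 reg.
- exact: Aalpha_col_sum reg.
Qed.

(** Powers of ['X - c%:P] stand on both sides because either of [#|G1|] and [m1] may be the
    larger. *)
Lemma char_poly_join :
  ('X - c%:P) ^+ #|G1| * char_poly (Aalpha alpha (Qedge_join G1 G2))
  = ('X - c%:P) ^+ m1
    * (\prod_(j <- index_iota 2 n2.+1)
         ('X - (alpha * m1%:R + lambda j (Aalpha alpha G2))%:P))
    * (\prod_(i <- index_iota 2 #|G1|.+1)
         join_quadratic (lambda i (Aalpha alpha G1)))
    * join_cubic.
Proof.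
(* The roots of [h] are the points where [a], [p] or [q] vanishes; [q] is the quadratic at [t1], the
   leading eigenvalue of [Aalpha alpha G1]. *)
pose h := ('X - (alpha * t1%:R)%:P) * ('X - (alpha * m1%:R + t2%:R)%:P)
  * join_quadratic t1%:R.
apply: (@poly_eq_off_roots _ _ _ h) => [|x].
  by rewrite !mulf_neq0 ?polyXsubC_eq0 // monic_neq0 // join_quadratic_monic.
rewrite /h !hornerM !hornerXsubC !mulf_eq0 !negb_or => /andP[/andP[a0 p0] q0].
set a := x - alpha * t1%:R in a0; set p := x - (_ + _) in p0.
pose b := 1 - alpha; pose d := x - c.
have qE l : (join_quadratic l).[x]
    = a * d - (a + b) * ((1 - 2 * alpha) * t1%:R) - (a + b) * l.
  rewrite /join_quadratic !(hornerD, hornerN, hornerM, hornerXn, hornerX, hornerC).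
  by rewrite /a /d /c /b -/n2; ring.
have qt : (join_quadratic t1%:R).[x] = a * d - b * (a + b) * (2 * t1%:R).
  by rewrite qE /b; ring.
have eP : \det ((x - alpha * m1%:R)%:M - Aalpha alpha G2)
    = p * \prod_(j <- index_iota 2 n2.+1)
         (x - (alpha * m1%:R + lambda j (Aalpha alpha G2))).
  rewrite -[X in \det (_ - X)]scale1r det_scalar_sub_scale; last first.
    exact: Aalpha_sym reg2.
  rewrite (Aalpha_eigenvalues _ _ reg2 G2_gt0) big_cons big_map mul1r.
  congr (_ * _); first by rewrite /p; ring.
  by apply: eq_bigr => j _; ring.
pose B := incidence_mx R G1.
have eQ : \det ((a * d)%:M - (b * (a + b)) *: (B *m B^T))
    = (join_quadratic t1%:R).[x] * \prod_(i <- index_iota 2 #|G1|.+1)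
         (join_quadratic (lambda i (Aalpha alpha G1))).[x].
  rewrite mulrC -(mulrC (a + b)) -scalerA (incidence_mul_tr _ alpha _ _ reg1).
  rewrite scalerDr opprD addrCA addrC scale_scalar_mx -raddfB /=.
  rewrite det_scalar_sub_scale; last exact: Aalpha_sym reg1.
  rewrite (Aalpha_eigenvalues _ _ reg1 G1_gt0) big_cons big_map.
  congr (_ * _); first by rewrite qE; ring.
  by apply: eq_bigr => j _; rewrite qE; ring.
have hs : t1%:R * #|G1|%:R = 2 * m1%:R :> R.
  rewrite -!natrM -[(2 * m1)%N]/(2 * #|edge G1|)%N.
  by have := handshake _ _ reg1; rewrite /graph_size /graph_order card_sig => ->.
have eC : join_cubic.[x] = p * (join_quadratic t1%:R).[x]
    - a * b ^+ 2 * n2%:R * t1%:R * #|G1|%:R / 2.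
  have -> : a * b ^+ 2 * n2%:R * t1%:R * #|G1|%:R / 2
      = a * b ^+ 2 * n2%:R * (t1%:R * #|G1|%:R) / 2 by ring.
  rewrite hs qt /join_cubic -polyC1.
  rewrite !(hornerD, hornerN, hornerM, hornerXn, hornerX, hornerC).
  by rewrite /a /d /c /b /p -/m1 -/n2; field.
have pE : ((x - alpha * m1%:R)%:M - Aalpha alpha G2) *m const_mx 1
    = p *: const_mx 1 :> 'cV_n2.
  rewrite mulmxBl (mul_Aalpha_ones _ _ _ _ reg2) mul_scalar_mx -scalerBl /p.
  by rewrite opprD addrA.
have two0 : 2 != 0 :> R by rewrite pnatr_eq0.
have := @det_join_block _ _ _ _ B _ a b d p t1%:R two0 a0 p0.
rewrite -qt => /(_ _ _ q0 (ones_mul_incidence R G1)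
  (incidence_mul_ones R _ _ reg1) pE) main.
rewrite !horner_exp !hornerXsubC !horner_prod.
rewrite (horner_char_poly_join _ _ _ _ _ _ _ reg1 reg2).
rewrite -/B -/m1 -/n2 -/a -/b -/c -/d.
under [X in _ = _ * X * _ * _]eq_bigr do rewrite hornerXsubC.
move: main; rewrite eP eQ -eC; set D := \det _.
move: (\prod_(_ <- _) _) (\prod_(_ <- _) _) join_cubic.[x] => r s e main.
(* The leading factors [p] from [G2] and [q] from [G1] occur on both sides; cancelling them leaves
   products that start at index 2. *)
apply: (mulIf q0); apply: (mulIf p0); move: main.
move: (d ^+ #|G1|) (d ^+ m1) (join_quadratic t1%:R).[x] => dn dm q main.
transitivity (D * dn * p * q); first by ring.
by rewrite main; ring.
Qed.

End JoinPolynomial.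

(** * Reading the spectrum off the factorisation *)

Lemma perm_eigenvalues (R : rcfType) (n : nat) (M : 'M[R]_n) (s : seq R) :
  char_poly M = \prod_(x <- s) ('X - x%:P) -> perm_eq (eigenvalues M) s.
Proof. by move=> eM; rewrite /eigenvalues eM root_seq_prod. Qed.

Theorem corollary4p1 (R : rcfType) (alpha : R) (G1 G2 : sgraph)
    (t1 n1 m1 t2 n2 : nat)
    (alpha01 : 0 <= alpha <= 1)
    (n1_gt0 : (0 < n1)%N) (n2_gt0 : (0 < n2)%N)
    (G1_order : graph_order G1 = n1) (G1_size : graph_size G1 = m1)
    (G1_reg : regular t1 G1)
    (G2_order : graph_order G2 = n2) (G2_reg : regular t2 G2) :
  (t1 = 1%N -> n1 = 2%N ->
    let cubic : {poly R} :=
      ('X - alpha%:P) * ('X - (2 * alpha)%:P - (alpha * n2%:R)%:P)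
        * ('X - alpha%:P - (t2%:R)%:P)
      - (2 * (1 - alpha) ^+ 2)%:P * ('X - alpha%:P - (t2%:R)%:P)
      - ((1 - alpha) ^+ 2)%:P * ('X - alpha%:P) * (n2%:R)%:P in
    size (root_seq cubic) = 3%N /\
    perm_eq (Aalpha_spectrum alpha (Qedge_join G1 G2))
      ([:: alpha]
       ++ [seq alpha + lambda j (Aalpha alpha G2) | j <- index_iota 2 n2.+1]
       ++ root_seq cubic))
  /\
  ((2 <= t1)%N ->
    let quadratic (i : nat) : {poly R} :=
      let li := lambda i (Aalpha alpha G1) in
      'X ^+ 2
      - (alpha * (t1%:R + n2%:R + 2) + t1%:R - 2 + li)%:P * 'X
      + (alpha ^+ 2 * t1%:R * n2%:R
         + (alpha * (t1%:R + 1) - 1) * (t1%:R + li))%:P in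
    let cubic : {poly R} :=
      ('X - (alpha * t1%:R)%:P)
        * ('X - (2 * alpha * t1%:R)%:P - (alpha * n2%:R)%:P)
        * ('X - (alpha * m1%:R)%:P - (t2%:R)%:P)
      - (2 * (1 - alpha) * (t1%:R - 1))%:P
        * ('X - (alpha * t1%:R)%:P + 1 - alpha%:P)
        * ('X - (alpha * m1%:R)%:P - (t2%:R)%:P)
      - (2 * (1 - alpha) ^+ 2)%:P * ('X - (alpha * m1%:R)%:P - (t2%:R)%:P)
      - (m1%:R * n2%:R * (1 - alpha) ^+ 2)%:P * ('X - (alpha * t1%:R)%:P) in
    [/\ (n1 <= m1)%N,
        size (root_seq cubic) = 3%N &
        perm_eq (Aalpha_spectrum alpha (Qedge_join G1 G2))
          (nseq (m1 - n1) (alpha * (2 * t1%:R + n2%:R + 2) - 2)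
           ++ [seq alpha * m1%:R + lambda j (Aalpha alpha G2)
                | j <- index_iota 2 n2.+1]
           ++ flatten [seq root_seq (quadratic i) | i <- index_iota 2 n1.+1]
           ++ root_seq cubic)]).
Proof.
have em : m1 = #|edge G1| by rewrite -G1_size /graph_size card_sig.
move: G1_order G2_order n1_gt0 n2_gt0; rewrite /graph_order.
move=> <- <- {n1 n2} G1_gt0 G2_gt0.
have := handshake _ _ G1_reg; rewrite G1_size /graph_order.
move: em => {G1_size} -> hs.
have := char_poly_join _ _ _ _ _ _ alpha01 G1_reg G2_reg G1_gt0 G2_gt0.
set c := alpha * _ - 2; set A := Aalpha alpha (Qedge_join G1 G2).
have symA : A^T = A.
  apply/matrixP => i j; rewrite !mxE (adj_sym (enum_val j)) eq_sym.
  by case: eqVneq => // ->.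
have splitA := symmetric_char_poly_splits _ _ _ symA.
have [sizeC monC] := join_cubic_monic R alpha G1 G2 t1 t2.
set C := join_cubic _ _ _ _ _ _ in sizeC monC *.
pose sC := root_seq C.
have sizeCE : C = \prod_(x <- sC) ('X - x%:P) -> size sC = 3%N.
  by move=> eC; move: sizeC; rewrite eC size_prod_XsubC => -[].
move=> main; split.
  move=> t1E n1E; set cubic := (X in root_seq X).
  have m1E : #|edge G1| = 1%N.
    by apply/eqP; rewrite -(eqn_pmul2l (_ : 0 < 2)%N) // hs t1E n1E.
  have iotaE : index_iota 2 #|G1|.+1 = [:: 2%N] by rewrite n1E.
  have powE : ('X - c%:P) ^+ #|G1| = ('X - c%:P) ^+ 2 by rewrite n1E.
  (* The trace is [2 * alpha] and the leading eigenvalue is [t1 = 1]. *)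
  have lambda1 : lambda 2 (Aalpha alpha G1) = 2 * alpha - 1.
    have := sum_eigenvalues _ _ _ G1_gt0 (Aalpha_sym R alpha _ _ G1_reg).
    rewrite (Aalpha_eigenvalues _ _ alpha01 _ _ G1_reg G1_gt0) iotaE t1E /=.
    rewrite big_cons big_seq1 /mxtrace.
    rewrite (eq_bigr (fun=> alpha)) => [|i _]; last first.
      by rewrite (AalphaE _ _ _ _ G1_reg) eqxx adj_irr t1E mulr1n mulr0n; ring.
    rewrite sumr_const card_ord [X in alpha *+ X]n1E mulr1n => tr1.
    by rewrite -[LHS](addKr 1) tr1; ring.
  (* One factor ['X - c%:P] makes up for [#|G1|] exceeding the number of edges by one; the other
     gives the simple eigenvalue [alpha]. *)
  have quadE : join_quadratic R alpha G2 t1 (2 * alpha - 1)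
      = ('X - c%:P) * ('X - alpha%:P).
    by rewrite /join_quadratic /c t1E; ring.
  move: main; rewrite iotaE big_seq1 lambda1 quadE powE m1E expr1.
  set tail := \prod_(_ <- index_iota 2 _) _ => main.
  have {main} eA : char_poly A = tail * ('X - alpha%:P) * C.
    apply: (@mulfI _ (('X - c%:P) ^+ 2)).
      by rewrite expf_neq0 // polyXsubC_eq0.
    by rewrite main; ring.
  have -> : cubic = C.
    by rewrite /cubic /C /join_cubic t1E m1E; ring.
  (* The cubic divides the characteristic polynomial of the symmetric matrix [A], which splits. *)
  have eC : C = \prod_(x <- sC) ('X - x%:P).
    by apply: (@root_seq_dvd _ (eigenvalues A)); rewrite // -splitA eA dvdp_mulIr.
  split; first exact: sizeCE.
  apply: perm_eigenvalues; rewrite eA !big_cat /= big_seq1 big_map -eC mulrA.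
  rewrite /tail (mulrC ('X - alpha%:P)); congr (_ * _ * _).
  by apply: eq_bigr => j _; rewrite mulr1.
move=> t1_ge2.
pose quadratic i := join_quadratic R alpha G2 t1 (lambda i (Aalpha alpha G1)).
change [/\ (#|G1| <= #|edge G1|)%N, size sC = 3%N &
  perm_eq (eigenvalues A) (nseq (#|edge G1| - #|G1|) c
    ++ [seq alpha * #|edge G1|%:R + lambda j (Aalpha alpha G2)
         | j <- index_iota 2 #|G2|.+1]
    ++ flatten [seq root_seq (quadratic i) | i <- index_iota 2 #|G1|.+1]
    ++ sC)].
(* The handshake identity gives [2 m1 = t1 n1], at least [2 n1]. *)
have n1_le_m1 : (#|G1| <= #|edge G1|)%N.
  by rewrite -(leq_pmul2l (_ : 0 < 2)%N) // hs leq_mul2r t1_ge2 orbT.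
move: main; set tail := \prod_(j <- index_iota 2 #|G2|.+1) _.
set quads := \prod_(j <- _) _ => main.
have {main} eA : char_poly A
    = ('X - c%:P) ^+ (#|edge G1| - #|G1|) * tail * quads * C.
  apply: (@mulfI _ (('X - c%:P) ^+ #|G1|)).
    by rewrite expf_neq0 // polyXsubC_eq0.
  by rewrite main -{1}(subnKC n1_le_m1) exprD !mulrA.
have eC : C = \prod_(x <- sC) ('X - x%:P).
  by apply: (@root_seq_dvd _ (eigenvalues A)); rewrite // -splitA eA dvdp_mulIr.
(* Keeping [i] in the index range exhibits each quadratic as a factor of the split polynomial of
   [A]. *)
have eq_quads : quads = \prod_(i <- index_iota 2 #|G1|.+1)
    \prod_(x <- root_seq (quadratic i)) ('X - x%:P).
  rewrite /quads big_seq [RHS]big_seq; apply: eq_bigr => i ri.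
  apply: (@root_seq_dvd _ (eigenvalues A)); first exact: join_quadratic_monic.
  rewrite -splitA eA; apply/dvdp_mulr/dvdp_mull.
  by rewrite /quads (big_rem i ri) /= dvdp_mulIl.
split=> //; first exact: sizeCE.
apply: perm_eigenvalues; rewrite eA !big_cat /= -eC !mulrA.
congr (_ * _ * _ * _).
- by rewrite big_nseq -Monoid.iteropE.
- by rewrite big_map.
- by rewrite eq_quads big_flatten big_map.
Qed.
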